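(* Let $M=(E,\mathcal I)$ be a loopless matroid with rank function $r$ and $r(E)>0$, and let $\mathcal B$ be its base family. Then the set of extreme points of $\mathrm{Adm}(\mathcal B)$ is exactly the set $\Theta=\Big\{\tfrac{1}{r(E)-r(E\setminus X)}\mathbf 1_X:\ \emptyset\ne X\subseteq E,\ \mathrm{cl}(E\setminus X)=E\setminus X,\ M/(E\setminus X)\text{ is connected}\Big\}.$
   Context: Bases are identified with their indicator vectors in $\mathbb R^E$; $\mathbf 1_X$ is the indicator vector of $X$. $\mathrm{Adm}(\mathcal B)=\{\rho\in\mathbb R^E_{\ge0}:\sum_{e\in B}\rho(e)\ge1\ \forall B\in\mathcal B\}$ (its set of extreme points is called the Fulkerson blocker family $\widehat{\mathcal B}$). Closure: $\mathrm{cl}(Z)=\{y\in E:r(Z\cup\{y\})=r(Z)\}$. Contraction $M/(E\setminus X)$: matroid on $X$ with rank function $W\mapsto r(W\cup(E\setminus X))-r(E\setminus X)$. A separator of a matroid $N$ on ground set $F$ is a set $Z\subseteq F$ such that every circuit of $N$ is contained in $Z$ or in $F\setminus Z$; $N$ is connected if its only separators are $\emptyset$ and $F$. *)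

(* Defs.v *)
From mathcomp Require Import all_boot all_order all_algebra.
From mathcomp Require Import boolp classical_sets reals.

Set Implicit Arguments.
Unset Strict Implicit.
Unset Printing Implicit Defensive.

Import Order.TTheory GRing.Theory Num.Theory.
Local Open Scope ring_scope.

(* The ground set of a matroid is the whole finite type [E]. *)
Record matroid (E : finType) := Matroid {
  indep : {set {set E}};
  indep0 : finset.set0 \in indep;
  indepS : forall I J : {set E}, I \subset J -> J \in indep -> I \in indep;
  indep_aug : forall I J : {set E}, I \in indep -> J \in indep ->
    (#|I| < #|J|)%N -> exists2 e, e \in J :\: I & e |: I \in indep }.

Section MatroidTheory.
Variables (E : finType) (M : matroid E).
Implicit Types (A B C I Z : {set E}).

Definition rank A : nat := (\max_(I in indep M | I \subset A) #|I|)%N.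

Definition bases : {set {set E}} := [set B : {set E} | maxset (fun A => A \in indep M) B]%SET.

Definition circuit C : bool := minset (fun A => A \notin indep M) C.

Definition loopless : Prop := forall e : E, ~~ circuit [set e]%SET.

Definition mclosure Z : {set E} := [set y | rank (y |: Z) == rank Z]%SET.

Definition separator Z : Prop :=
  forall C, circuit C -> C \subset Z \/ C \subset ~: Z.

Definition connected : Prop :=
  forall Z, separator Z -> Z = finset.set0 \/ Z = finset.setT.

Lemma indep_rank I A : I \in indep M -> I \subset A -> (#|I| <= rank A)%N.
Proof. by move=> II IA; apply: (bigop.bigmax_sup I) => //; rewrite II. Qed.

Lemma rankS A B : A \subset B -> (rank A <= rank B)%N.
Proof.
move=> AB; apply/bigop.bigmax_leqP => I /andP[II IA].
exact: indep_rank II (fintype.subset_trans IA AB).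
Qed.

Lemma rank_extend I A : I \in indep M -> I \subset A ->
  exists J, [/\ J \in indep M, I \subset J, J \subset A & #|J| = rank A].
Proof.
move=> II IA.
have [J /maxsetP[/andP[JI JA] Jmax] IJ] :
    {J : {set E} | maxset (fun K => (K \in indep M) && (K \subset A)) J & I \subset J}.
  by apply: maxset_exists; rewrite II.
exists J; split=> //; apply/eqP; rewrite eqn_leq indep_rank //=.
apply/bigop.bigmax_leqP => K /andP[KI KA]; rewrite leqNgt; apply/negP => ltJK.
have [e] := indep_aug JI KI ltJK; rewrite inE => /andP[eJ eK] eJI.
have eq : e |: J = J.
  apply: Jmax; last exact: finset.subsetUr.
  rewrite eJI finset.subUset JA andbT finset.sub1set.
  exact: (fintype.subsetP KA).
by move: eJ; rewrite -eq finset.setU11.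
Qed.

Lemma rank_basis Z : exists B, [/\ B \in indep M, B \subset Z & #|B| = rank Z].
Proof.
have [B [BI _ BZ cB]] := rank_extend (indep0 M) (finset.sub0set Z).
by exists B.
Qed.

Section Contraction.
Variable Z : {set E}.
Local Notation F := {x : E | x \in ~: Z}.
Implicit Types (J W : {set F}).

(* [W] is independent in the contraction when r (W :|: Z) - r Z = #|W|. *)
Definition contract_indep : {set {set F}} :=
  [set W : {set F} | #|W| + rank Z == rank ([set val x | x in W] :|: Z)]%N%SET.

Let lift W : {set E} := (val @: W)%SET.

Let card_lift W : #|lift W| = #|W|.
Proof. exact/card_imset/val_inj. Qed.

Let lift_notin W x : x \in lift W -> x \notin Z.
Proof. by case/imsetP => y _ ->; have := valP y; rewrite inE. Qed.

Let card_liftU W B : B \subset Z -> #|lift W :|: B| = (#|W| + #|B|)%N.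
Proof.
move=> BZ; rewrite cardsU card_lift.
suff -> : lift W :&: B = finset.set0 by rewrite cards0 subn0.
apply/setP => x; rewrite !inE; apply/negP => /andP[/lift_notin xZ xB].
by move: xZ; rewrite (fintype.subsetP BZ).
Qed.

Let capZ B K : B \subset Z -> #|B| = rank Z -> K \in indep M -> B \subset K ->
  K :&: Z = B.
Proof.
move=> BZ cB KI BK; apply/esym/eqP; rewrite eqEcard finset.subsetI BK BZ /= cB.
by apply: indep_rank; [exact: indepS (finset.subsetIl _ _) KI | exact: finset.subsetIr].
Qed.

Let contract_indepE B W : B \in indep M -> B \subset Z -> #|B| = rank Z ->
  (W \in contract_indep) = (lift W :|: B \in indep M).
Proof.
move=> BI BZ cB; rewrite inE -/(lift W); apply/idP/idP => [/eqP cW|WI].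
  have BU : B \subset lift W :|: Z by rewrite finset.subsetU // BZ orbT.
  have [K [KI BK KU cK]] := rank_extend BI BU.
  have KW : K \subset lift W :|: B.
    apply/fintype.subsetP => x xK; have := fintype.subsetP KU x xK.
    rewrite !inE => /orP[->//|xZ].
    by rewrite -(capZ BZ cB KI BK) inE xK xZ orbT.
  suff <- : K = lift W :|: B by [].
  by apply/eqP; rewrite eqEcard KW card_liftU // cB cW cK leqnn.
rewrite eqn_leq -{1}cB -card_liftU // indep_rank ?finset.setUS //=.
have [K [KI KU cK]] := rank_basis (lift W :|: Z); rewrite -cK.
rewrite -(cardsID Z K) addnC leq_add //.
  rewrite -card_lift subset_leq_card //; apply/fintype.subsetP => x.
  rewrite inE => /andP[xZ /(fintype.subsetP KU)].
  by rewrite inE (negPf xZ) orbF.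
by apply: indep_rank; [exact: indepS (finset.subsetIl _ _) KI | exact: finset.subsetIr].
Qed.

Fact contract_indep0 : finset.set0 \in contract_indep.
Proof. by rewrite inE finset.imset0 cards0 finset.set0U. Qed.

Fact contract_indepS W J : W \subset J -> J \in contract_indep ->
  W \in contract_indep.
Proof.
have [B [BI BZ cB]] := rank_basis Z.
rewrite !(contract_indepE _ BI BZ cB) => WJ; apply: indepS.
by rewrite finset.setSU // imsetS.
Qed.

Fact contract_indep_aug W J : W \in contract_indep -> J \in contract_indep ->
  (#|W| < #|J|)%N -> exists2 e, e \in J :\: W & e |: W \in contract_indep.
Proof.
have [B [BI BZ cB]] := rank_basis Z.
rewrite !(contract_indepE _ BI BZ cB) => WI JI ltWJ.
have [|e] := indep_aug WI JI; first by rewrite !card_liftU // ltn_add2r.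
rewrite !inE negb_or => /andP[/andP[eW eB]]; rewrite (negPf eB) orbF.
case/imsetP => f fJ ef; rewrite {}ef in eW eB * => fI; exists f.
  by rewrite inE fJ andbT; apply: contra eW => fW; apply: imset_f.
by rewrite (contract_indepE _ BI BZ cB) /lift imsetU1 -finset.setUA.
Qed.

(* M / Z, a matroid on E \ Z; its rank function is given by [rank_contract]. *)
Definition contract : matroid F :=
  Matroid contract_indep0 contract_indepS contract_indep_aug.

End Contraction.
End MatroidTheory.

Lemma rank_contract (E : finType) (M : matroid E) (Z : {set E})
    (W : {set {x : E | x \in ~: Z}}) :
  rank (contract M Z) W
    = (rank M ([set val x | x in W]%SET :|: Z) - rank M Z)%N.
Proof.
apply/eqP; rewrite eqn_leq; apply/andP; split.
  apply/bigop.bigmax_leqP => J /andP[]; rewrite inE => /eqP cJ JW.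
  rewrite leq_subRL; last by rewrite rankS // finset.subsetUr.
  by rewrite addnC cJ rankS // finset.setSU // imsetS.
have [B [BI BZ cB]] := rank_basis M Z.
have BU : B \subset [set val x | x in W]%SET :|: Z.
  by rewrite finset.subsetU // BZ orbT.
have [K [KI BK KU cK]] := rank_extend BI BU.
have KZ : K :&: Z = B.
  apply/esym/eqP; rewrite eqEcard finset.subsetI BK BZ /= cB.
  by apply: indep_rank; [exact: indepS (finset.subsetIl _ _) KI | exact: finset.subsetIr].
pose J : {set {x : E | x \in ~: Z}} := [set x | val x \in K]%SET.
have JE : [set val x | x in J]%SET = K :\: Z.
  apply/setP => x; apply/imsetP/idP => [[y]|].
    by rewrite inE => yK ->; rewrite inE yK andbT; have := valP y; rewrite inE.
  rewrite inE => /andP[xZ xK]; have xZ' : x \in ~: Z by rewrite inE.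
  by exists (exist _ x xZ'); rewrite ?inE.
have cJ : #|J| = #|K :\: Z| by rewrite -JE; apply/esym/card_imset/val_inj.
have cKD : (#|K :\: Z| + rank M Z)%N = #|K|.
  by rewrite -(cardsID Z K) KZ cB addnC.
have JW : J \subset W.
  apply/fintype.subsetP => x; rewrite inE => /(fintype.subsetP KU).
  rewrite inE; have := valP x; rewrite inE => /negPf ->; rewrite orbF.
  by case/imsetP => y yW /val_inj ->.
have JZ : [set val x | x in J]%SET :|: Z = K :|: Z.
  by rewrite JE; apply/setP => x; rewrite !inE; case: (x \in Z); rewrite ?orbT.
have rKZ : rank M (K :|: Z) = #|K|.
  apply/eqP; rewrite eqn_leq indep_rank ?finset.subsetUl // andbT cK.
  by rewrite rankS // finset.subUset KU finset.subsetUr.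
rewrite -cK -cKD addnK -cJ; apply: indep_rank => //.
by rewrite inE JZ rKZ cJ cKD.
Qed.

Section Blocker.
Variables (R : realType) (E : finType).
Local Open Scope classical_set_scope.

(* Vectors indexed by [E]; [R^o] provides the module structure over [R]. *)
Definition admissible (Bs : {set {set E}}) : set {ffun E -> R^o} :=
  [set rho | (forall e, 0 <= rho e) /\
             (forall B : {set E}, B \in Bs -> 1 <= \sum_(e in B) rho e)].

Definition extreme_points (V : lmodType R) (A : set V) : set V :=
  [set x | A x /\ forall (y z : V) (t : R), A y -> A z -> 0 < t < 1 ->
                    x = t *: y + (1 - t) *: z -> y = x /\ z = x].

Definition indicator (X : {set E}) : {ffun E -> R^o} :=
  [ffun e => (e \in X)%:R].

Definition Theta (M : matroid E) : set {ffun E -> R^o} :=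
  [set rho | exists X : {set E},
    [/\ X <> finset.set0,
        mclosure M (~: X) = ~: X,
        connected (contract M (~: X)) &
        rho = ((rank M finset.setT)%:R - (rank M (~: X))%:R)^-1 *: indicator X]].

End Blocker.

Arguments admissible R {E} Bs.
Arguments indicator R {E} X.
Arguments Theta R {E} M.

(* Main.v *)
(** At an extreme point rho, a direction d vanishes as soon as it is zero where
    rho is zero and has weight 0 on every tight base, i.e. every base of
    rho-weight 1. Let Z be the zero set of rho and X its complement. By base
    exchange every tight base spans Z, so it meets X in a base of M / Z. Three
    directions give the inclusion in Theta: 1_X - (r(E) - r(Z)) rho shows that rho
    is a multiple of 1_X; 1_{e} shows that no e in X lies in cl(Z); and, for a
    separator S of M / Z, which meets all bases of M / Z in the same number m of
    elements, 1_S - m rho shows that S is trivial.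

    Conversely, when 1_X / (r(E) - r(E \ X)) is a proper convex combination of two
    admissible vectors, both vanish off X and give weight 1 to every base of
    M / (E \ X), hence are constant on X by connectedness. *)
Require Import Defs.
From mathcomp Require Import all_boot all_order all_algebra.
From mathcomp Require Import boolp classical_sets reals.

Set Implicit Arguments.
Unset Strict Implicit.
Unset Printing Implicit Defensive.

Import Order.TTheory GRing.Theory Num.Theory.
Local Open Scope ring_scope.

(** * Bases, circuits and separators of a matroid *)

Section MatroidBases.
Variables (E : finType) (M : matroid E).
Implicit Types (A B C I W Z : {set E}).

Lemma basesP B :
  reflect (B \in indep M /\ #|B| = rank M [set: E]%SET) (B \in bases M).
Proof.
rewrite inE; apply: (iffP maxsetP) => [[BI Bmax]|[BI cB]]; split=> //.
  have [J [JI BJ _ <-]] := rank_extend BI (finset.subsetT B).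
  by rewrite (Bmax J).
move=> A AI BA; apply/esym/eqP; rewrite eqEcard BA cB.
by apply: indep_rank => //; exact: finset.subsetT.
Qed.

Lemma base_extend I A : I \in indep M -> I \subset A ->
  rank M A = rank M [set: E]%SET ->
  exists B, [/\ B \in bases M, I \subset B & B \subset A].
Proof.
move=> II IA rA; have [J [JI IJ JA cJ]] := rank_extend II IA.
by exists J; split=> //; apply/basesP; rewrite -rA.
Qed.

Lemma base_rank_full A B : B \in bases M -> B \subset A ->
  rank M A = rank M [set: E]%SET.
Proof.
move=> /basesP[BI cB] BA; apply/eqP; rewrite eqn_leq rankS ?finset.subsetT //=.
by rewrite -cB indep_rank.
Qed.

Lemma circuit_proper_indep C A : circuit M C -> A \proper C -> A \in indep M.
Proof.
move=> /minsetP[_ Cmin] /andP[AC CA]; apply/negPn/negP => AnI.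
by move: CA; rewrite -{1}(Cmin A AnI AC) fintype.subxx.
Qed.

Lemma circuit_not_sub C A : circuit M C -> A \in indep M -> ~~ (C \subset A).
Proof.
move=> /minsetP[CnI _] AI; apply: contra CnI => CA; exact: indepS CA AI.
Qed.

(** Take [W] to be [B :\ f] for a base [B] containing [C :\ e]. A base that contains [C :\ f] and
    lies in its union with [B] must omit [f], since it cannot contain [C]; it thus lies in [e |: W],
    and equals it by cardinality. *)
Lemma circuit_exchange C e f : circuit M C -> e \in C -> f \in C -> e != f ->
  exists W, [/\ e \notin W, f \notin W, e |: W \in bases M & f |: W \in bases M].
Proof.
move=> CC eC fC nef.
have [B [BB CB _]] := base_extend
  (circuit_proper_indep CC (finset.properD1 eC)) (finset.subsetT _) erefl.
have eB : e \notin B.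
  apply: contra (circuit_not_sub CC (proj1 (elimT (basesP B) BB))) => eB.
  by rewrite -(finset.setD1K eC) finset.subUset finset.sub1set eB.
have fB : f \in B.
  by apply: (fintype.subsetP CB); rewrite !inE eq_sym nef.
have [B' [BB' CB' BA']] := base_extend
  (circuit_proper_indep CC (finset.properD1 fC)) (finset.subsetUl _ B)
  (base_rank_full BB (finset.subsetUr _ B)).
have fB' : f \notin B'.
  apply: contra (circuit_not_sub CC (proj1 (elimT (basesP B') BB'))) => fB'.
  by rewrite -(finset.setD1K fC) finset.subUset finset.sub1set fB'.
exists (B :\ f); split; last by rewrite finset.setD1K.
- by rewrite !inE (negPf eB) andbF.
- by rewrite !inE eqxx.
suff <- : B' = e |: (B :\ f) by [].
have sub : B' \subset e |: (B :\ f).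
  apply/fintype.subsetP => x xB'; have := fintype.subsetP BA' x xB'.
  rewrite !inE; have -> : x != f by apply: contraNneq fB' => <-.
  case: eqVneq => //= xe /orP[xC|//].
  by apply: (fintype.subsetP CB); rewrite !inE xe.
apply/eqP; rewrite eqEcard sub cardsU1 !inE (negPf eB) andbF /=.
move: BB BB' => /basesP[_ cB] /basesP[_ ->].
by rewrite -cB (cardsD1 f B) fB.
Qed.

(** A circuit inside the union would lie on one side of [Z], hence inside [I] or inside [J]. *)
Lemma separator_indepU Z I J : separator M Z -> I \in indep M -> J \in indep M ->
  I \subset Z -> J \subset ~: Z -> I :|: J \in indep M.
Proof.
move=> sepZ II JI IZ JZ; apply/negPn/negP => UnI.
have [C CC CU] := minset_exists (P := fun A => A \notin indep M) UnI.
have [CZ|CZ] := sepZ C CC.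
  move: (circuit_not_sub CC II) => /negP; apply.
  apply/fintype.subsetP => x xC; have := fintype.subsetP CU x xC.
  rewrite inE => /orP[//|/(fintype.subsetP JZ)].
  by rewrite inE (fintype.subsetP CZ).
move: (circuit_not_sub CC JI) => /negP; apply.
apply/fintype.subsetP => x xC; have := fintype.subsetP CU x xC.
rewrite inE => /orP[/(fintype.subsetP IZ)|//].
by have := fintype.subsetP CZ x xC; rewrite inE => /negPf ->.
Qed.

(** Replacing the part of [B'] in [Z] by that of [B] keeps independence, so the result cannot be
    larger than the base [B']. *)
Lemma separator_card_le Z B B' : separator M Z ->
  B \in bases M -> B' \in bases M -> (#|B :&: Z| <= #|B' :&: Z|)%N.
Proof.
move=> sepZ /basesP[BI _] /basesP[BI' cB'].
have UI : (B :&: Z) :|: (B' :\: Z) \in indep M.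
  apply: separator_indepU sepZ _ _ (finset.subsetIr _ _) _.
  - exact: indepS (finset.subsetIl _ _) BI.
  - exact: indepS (finset.subsetDl _ _) BI'.
  - by rewrite finset.setDE finset.subsetIr.
have := indep_rank UI (finset.subsetT _).
rewrite -cB' -(cardsID Z B') cardsU.
have -> : (B :&: Z) :&: (B' :\: Z) = finset.set0.
  by apply/setP => x; rewrite !inE; case: (x \in Z); rewrite !(andbF, andFb).
by rewrite cards0 subn0 leq_add2r.
Qed.

Lemma separator_card Z B B' : separator M Z ->
  B \in bases M -> B' \in bases M -> #|B :&: Z| = #|B' :&: Z|.
Proof.
by move=> sepZ BB BB'; apply/eqP; rewrite eqn_leq !separator_card_le.
Qed.

Lemma base_cap_rank Z B : B \in bases M -> (#|B :&: Z| <= rank M Z)%N.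
Proof.
move=> /basesP[BI _]; apply: indep_rank; last exact: finset.subsetIr.
exact: indepS (finset.subsetIl _ _) BI.
Qed.

(** If [e] were in [B], then [e |: (B :&: Z)] would be an independent subset of [e |: Z] with one
    element more than the rank of that set. *)
Lemma spanning_base_notin_closure Z B e : B \in bases M ->
  #|B :&: Z| = rank M Z -> e \in mclosure M Z -> e \notin Z -> e \notin B.
Proof.
move=> BB cB; rewrite inE => /eqP re eZ; apply/negP => eB.
have /basesP[BI _] := BB.
have := @indep_rank _ M (B :&: (e |: Z)) (e |: Z).
rewrite re -cB => /(_ (indepS (finset.subsetIl _ _) BI) (finset.subsetIr _ _)).
have -> : B :&: (e |: Z) = e |: (B :&: Z).
  by apply/setP => x; rewrite !inE; case: eqVneq => [->|]; rewrite ?eB.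
by rewrite cardsU1 !inE (negPf eZ) andbF ltnn.
Qed.

(** Augment [B :&: Z] by some [e] of [Z], then complete it to a base inside [e |: B]. That base
    keeps [B :&: Z], so the one element [f] of [B] that it drops lies outside [Z]. *)
Lemma base_exchange_into Z B : B \in bases M -> (#|B :&: Z| < rank M Z)%N ->
  exists e f, [/\ e \in Z, f \in B :\: Z, e \notin B & e |: (B :\ f) \in bases M].
Proof.
move=> BB lt; have /basesP[BI cB] := BB.
have [I [II IZ cI]] := rank_basis M Z.
have [|e] := indep_aug (indepS (finset.subsetIl B Z) BI) II; first by rewrite cI.
rewrite !inE => /andP[eBZ eI] eUI.
have eZ := fintype.subsetP IZ e eI.
have eB : e \notin B by move: eBZ; rewrite eZ andbT.
have [B' [BB' UB' BA']] := base_extend eUI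
  (finset.setUS [set e]%SET (finset.subsetIl B Z))
  (base_rank_full BB (finset.subsetUr _ B)).
have /basesP[_ cB'] := BB'.
have eB' : e \in B' by apply: (fintype.subsetP UB'); rewrite !inE eqxx.
have [f fB fB'] : exists2 f, f \in B & f \notin B'.
  apply/fintype.subsetPn/negP => BB1.
  have : (e |: B) \subset B' by rewrite finset.subUset finset.sub1set eB'.
  by move/subset_leq_card; rewrite cardsU1 eB cB' -cB ltnn.
exists e, f; split=> //.
  rewrite inE fB andbT; apply: contra fB' => fZ.
  by apply: (fintype.subsetP UB'); rewrite !inE fB fZ orbT.
suff <- : B' = e |: (B :\ f) by [].
apply/eqP; rewrite eqEcard; apply/andP; split; last first.
  by rewrite cardsU1 !inE (negPf eB) andbF /= cB' -cB (cardsD1 f B) fB.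
apply/fintype.subsetP => x xB'; have := fintype.subsetP BA' x xB'.
by rewrite !inE; have -> : x != f by apply: contraNneq fB' => <-.
Qed.

End MatroidBases.

(** * Correspondence between bases of [M] and bases of [M / Z] *)

Section ContractBases.
Variables (E : finType) (M : matroid E) (Z : {set E}).
Implicit Types B : {set E}.
Local Notation F := {x : E | x \in ~: Z}.

Lemma val_setT : [set val x | x in [set: F]]%SET = ~: Z.
Proof.
apply/setP => x; apply/imsetP/idP => [[y _ ->]|xZ]; first exact: valP.
by exists (exist _ x xZ).
Qed.

Lemma val_preim B : [set val x | x in [set x : F | val x \in B]]%SET = B :\: Z.
Proof.
apply/setP => x; apply/imsetP/idP => [[y]|].
  by rewrite inE => yB ->; rewrite inE yB andbT; have := valP y; rewrite inE.
rewrite inE => /andP[xZ xB]; have xZ' : x \in ~: Z by rewrite inE.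
by exists (exist _ x xZ'); rewrite ?inE.
Qed.

Lemma rank_contractT :
  rank (contract M Z) [set: F]%SET = (rank M [set: E]%SET - rank M Z)%N.
Proof. by rewrite rank_contract val_setT finset.setUC finset.setUCr. Qed.

Lemma contract_base B : B \in bases M -> #|B :&: Z| = rank M Z ->
  [set x : F | val x \in B]%SET \in bases (contract M Z).
Proof.
move=> BB cBZ; have /basesP[_ cB] := BB.
have cW : #|[set x : F | val x \in B]%SET| = #|B :\: Z|.
  by rewrite -val_preim; apply/esym/card_imset/val_inj.
apply/basesP; split; last first.
  by rewrite rank_contractT -cB -(cardsID Z B) cBZ addKn.
rewrite inE cW val_preim -cBZ addnC cardsID cB.
have -> : (B :\: Z) :|: Z = B :|: Z.
  by apply/setP => x; rewrite !inE; case: (x \in Z); rewrite ?orbT.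
by rewrite (base_rank_full BB (finset.subsetUl _ _)).
Qed.

(** The union of [Z] and the image [L] of [W] has full rank, so it contains a base of [M]. At most
    [rank M Z] elements of that base lie in [Z], which leaves enough outside [Z] to fill [L]. *)
Lemma contract_base_lift (W : {set F}) : W \in bases (contract M Z) ->
  exists2 B, B \in bases M & B :\: Z = [set val x | x in W]%SET.
Proof.
set L := [set val x | x in W]%SET.
move=> /basesP[]; rewrite inE -/L rank_contractT => /eqP cWZ cW.
have cL : #|L| = #|W| by apply/card_imset/val_inj.
have [B0 [BI0 BZ0 cB0]] := rank_basis M Z.
have rU : rank M (L :|: Z) = rank M [set: E]%SET.
  by rewrite -cWZ cW subnK // rankS // finset.subsetT.
have [|B [BB _ BU]] := base_extend BI0 _ rU.
  by rewrite finset.subsetU // BZ0 orbT.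
exists B => //; apply/eqP; rewrite eqEcard; apply/andP; split.
  apply/fintype.subsetP => x; rewrite inE => /andP[xZ /(fintype.subsetP BU)].
  by rewrite inE (negPf xZ) orbF.
have /basesP[_ cB] := BB.
have := base_cap_rank Z BB.
by rewrite cL -(leq_add2r #|B :\: Z|) cardsID cB -rU -cWZ addnC leq_add2l.
Qed.

End ContractBases.

(** * Perturbations around an extreme point *)

Section Extreme.
Variables (R : realType) (E : finType).
Implicit Types (rho d y z : {ffun E -> R^o}).

(** Constraint [i] tolerates every step up to [a i] over the absolute value of [b i], and any step
    when [b i] is zero; the minimum over the finitely many [i] works for all. The value 1 stands for
    the absence of a bound and also starts the minimum. *)
Lemma uniform_perturbation (I : finType) (a b : I -> R) :
  (forall i, 0 <= a i) -> (forall i, a i = 0 -> b i = 0) ->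
  exists2 c, 0 < c & forall s i, `|s| <= c -> 0 <= a i + s * b i.
Proof.
move=> a0 ab; pose g i := if b i == 0 then 1 else a i / `|b i|.
exists (\big[Order.min/1]_i g i).
  elim/big_ind: _ => // [x y x0 y0|i _]; first by rewrite lt_min x0.
  rewrite /g; case: eqVneq => //= bi; rewrite divr_gt0 ?normr_gt0 // lt0r a0 andbT.
  by apply: contra_neq bi; exact: ab.
move=> s i sc; have : `|s| <= g i.
  by apply: le_trans sc _; rewrite (bigD1 i) //= ge_min lexx.
rewrite /g; case: eqVneq => [->|bi]; first by rewrite mulr0 addr0.
rewrite ler_pdivlMr ?normr_gt0 // -normrM ler_norml => /andP[sb _].
by rewrite -lerBlDl sub0r.
Qed.

(* The constraints active at an extreme point determine it. *)
Lemma extreme_rigid (Bs : {set {set E}}) rho d :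
  extreme_points (admissible R Bs) rho ->
  (forall e, rho e = 0 -> d e = 0) ->
  (forall B, B \in Bs -> \sum_(e in B) rho e = 1 -> \sum_(e in B) d e = 0) ->
  d = 0.
Proof.
move=> [[rho0 rho1] ext] d0 dB.
have [c1 c1_gt0 c1P] := uniform_perturbation rho0 d0.
(* Slacks and their variations, set to 0 outside [Bs] so that the constraints are indexed by all
   subsets of [E]. *)
pose a (B : {set E}) : R := if B \in Bs then \sum_(e in B) rho e - 1 else 0.
pose b (B : {set E}) : R := if B \in Bs then \sum_(e in B) d e else 0.
have [||c2 c2_gt0 c2P] := @uniform_perturbation _ a b.
- by move=> B; rewrite /a; case: ifP => // BB; rewrite subr_ge0 rho1.
- by move=> B; rewrite /a /b; case: ifP => // BB /eqP; rewrite subr_eq0 => /eqP /dB; apply.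
pose c := Num.min c1 c2.
have c0 : 0 < c by rewrite lt_min c1_gt0.
have adm s : `|s| <= c -> admissible R Bs (rho + s *: d).
  rewrite le_min => /andP[sc1 sc2]; split=> [f|B BB].
    by rewrite !ffunE; exact: c1P.
  under eq_bigr do rewrite !ffunE.
  rewrite big_split /= -mulr_sumr -subr_ge0 addrAC.
  by have := c2P s B sc2; rewrite /a /b BB.
have h01 : (0 < (2^-1 : R)) && ((2^-1 : R) < 1).
  by rewrite invr_gt0 ltr0n invf_lt1 ?ltr0n ?ltr1n.
have admD : admissible R Bs (rho + c *: d) by apply: adm; rewrite gtr0_norm.
have admB : admissible R Bs (rho + (- c) *: d).
  by apply: adm; rewrite normrN gtr0_norm.
(* [rho] is the midpoint of the two admissible vectors, so [rho + c *: d] equals [rho], with [c]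
   nonzero. *)
have [|/eqP + _] := ext _ _ _ admD admB h01.
  have h : 1 - 2^-1 = 2^-1 :> R by rewrite {1}(splitr 1) div1r addrK.
  by rewrite h -scalerDr addrACA -scalerDl subrr scale0r addr0 -mulr2n
    -scaler_nat scalerA mulVf ?pnatr_eq0 // scale1r.
by rewrite addrC -subr_eq0 addrK scaler_eq0 (gt_eqF c0) => /eqP.
Qed.

End Extreme.

(** * Extreme points of the admissible set and the family [Theta] *)

Section Blocker.
Variables (R : realType) (E : finType) (M : matroid E).
Implicit Types (rho y z : {ffun E -> R^o}) (A B X Z : {set E}).
Local Notation rk A := (rank M A).
Local Notation Adm := (admissible R (bases M)).

Lemma sum_indicator A B : \sum_(e in B) indicator R A e = #|B :&: A|%:R.
Proof.
rewrite -sumr_const [RHS](eq_bigl (fun e => (e \in B) && (e \in A))) => [|e].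
  by rewrite [RHS]big_mkcondr; apply: eq_bigr => e _; rewrite ffunE; case: ifP.
by rewrite inE.
Qed.

Lemma base_cardD Z B : B \in bases M -> #|B :&: Z| = rk Z ->
  #|B :\: Z| = (rk [set: E]%SET - rk Z)%N.
Proof. by move=> /basesP[_ <-] <-; rewrite -(cardsID Z B) addKn. Qed.

Lemma base_cardD_ge Z B : B \in bases M ->
  (rk [set: E]%SET - rk Z <= #|B :\: Z|)%N.
Proof.
move=> BB; have /basesP[_ <-] := BB.
by rewrite -(cardsID Z B) leq_subLR leq_add2r base_cap_rank.
Qed.

(* Otherwise an exchange into the zero set would lower the weight below 1. *)
Lemma tight_base_spans_zeros rho B : Adm rho -> B \in bases M ->
  \sum_(e in B) rho e = 1 ->
  #|B :&: [set e | rho e == 0]%SET| = rk [set e | rho e == 0]%SET.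
Proof.
set Z := [set e | _]%SET => -[rho0 rho1] BB sB.
apply/eqP; rewrite eqn_leq base_cap_rank //= leqNgt; apply/negP.
move=> /(base_exchange_into BB)[e [f [eZ fBZ eB BB']]].
have := rho1 _ BB'; rewrite leNgt => /negP; apply.
move: eZ fBZ; rewrite !inE => /eqP e0 /andP[f0 fB].
rewrite big_setU1 ?inE ?(negPf eB) ?andbF //= e0 add0r.
by rewrite -sB [X in _ < X](big_setD1 f) //= ltrDr lt0r f0 rho0.
Qed.

Lemma card_lift Z (A : {set {x : E | x \in ~: Z}}) B :
  #|[set x : {x : E | x \in ~: Z} | val x \in B]%SET :&: A|
    = #|B :&: [set val x | x in A]%SET|.
Proof.
rewrite -(card_imset _ val_inj); apply: eq_card => x.
apply/imsetP/idP => [[u]|].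
  by rewrite inE inE => /andP[uB uA] ->; rewrite inE uB imset_f.
by rewrite inE => /andP[xB /imsetP[u uA xu]]; exists u; rewrite // !inE -xu xB.
Qed.

Lemma base_exists : exists B, B \in bases M.
Proof.
have [B [BI _ cB]] := rank_basis M [set: E]%SET.
by exists B; apply/basesP.
Qed.

Lemma extreme_Theta rho : extreme_points Adm rho -> Theta R M rho.
Proof.
move=> ext; have [rhoA _] := ext; have [rho0 rho1] := rhoA.
set Z := [set e | rho e == 0]%SET; set k := (rk [set: E]%SET - rk Z)%N.
have tight B : B \in bases M -> \sum_(e in B) rho e = 1 -> #|B :&: Z| = rk Z.
  exact: tight_base_spans_zeros.
have memZ e : (e \in Z) = (rho e == 0) by rewrite inE. clearbody Z.
(* Rigidity for the direction [indicator R A - m%:R *: rho]: it vanishes on [Z], and a tight base,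
   which spans [Z], gives it weight [m - m]. *)
have prop_ind A m : A \subset ~: Z ->
    (forall B, B \in bases M -> #|B :&: Z| = rk Z -> #|B :&: A| = m) ->
    forall e, (e \in A)%:R = m%:R * rho e.
  move=> AZ Am e; have d0 : indicator R A - m%:R *: rho = 0.
    apply: (extreme_rigid ext) => [f f0|B BB sB].
      rewrite !ffunE f0 scaler0 subr0.
      case: (boolP (f \in A)) => // /(fintype.subsetP AZ).
      by rewrite inE memZ f0 eqxx.
    transitivity (\sum_(f in B) indicator R A f - m%:R * \sum_(f in B) rho f).
      by rewrite mulr_sumr -sumrB; apply: eq_bigr => f _; rewrite !ffunE.
    by rewrite sum_indicator sB mulr1 Am ?subrr // tight.
  by move/ffunP: d0 => /(_ e); rewrite !ffunE => /eqP; rewrite subr_eq0 => /eqP.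
have kE e : (e \in ~: Z)%:R = k%:R * rho e.
  apply: prop_ind => // B BB cB.
  by rewrite -finset.setDE; exact: base_cardD.
(* If [rho] vanished everywhere, no base could have weight at least 1. *)
have [x0 x0Z] : exists x, x \notin Z.
  have [B BB] := base_exists; apply/existsP; apply: contraT => /existsPn Zall.
  have := rho1 B BB; rewrite big1 ?ler10 // => e _.
  by have := Zall e; rewrite negbK memZ => /eqP.
have k0 : k%:R != 0 :> R.
  apply: contraTneq x0Z => k0; have := kE x0; rewrite k0 mul0r inE.
  by case: (x0 \in Z) => // /eqP; rewrite oner_eq0.
exists (~: Z); rewrite finset.setCK; split.
- by move=> /setP/(_ x0); rewrite !inE (negPf x0Z).
- apply/setP => e; rewrite [LHS]inE; apply/idP/idP; last first.
    by move=> eZ; rewrite (finset.setUidPr _) // finset.sub1set.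
  move=> ecl; apply: contraT => eZ.
  have eX : [set e]%SET \subset ~: Z by rewrite finset.sub1set inE.
  (* The case [m = 0] of [prop_ind]: bases spanning [Z] avoid [e], which would make the indicator of
     [e] vanish at [e] itself. *)
  have eB B : B \in bases M -> #|B :&: Z| = rk Z -> #|B :&: [set e]%SET| = 0%N.
    move=> BB cB; have eB : e \notin B.
      by apply: spanning_base_notin_closure BB cB _ eZ; rewrite inE.
    by apply/eqP; rewrite cards_eq0 finset.setI_eq0 disjoint_sym finset.disjoints1.
  have /eqP := prop_ind _ _ eX eB e.
  by rewrite mul0r finset.set11 oner_eq0.
- move=> S sepS; case: (eqVneq S finset.set0) => [->|/set0Pn[u uS]]; first by left.
  right; apply/setP => v; rewrite [RHS]inE; apply: contraT => vS.
  (* A reference base of [M / Z] supplies the common number [m] of elements that bases share with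
     [S]. *)
  have [W0 [WI0 _ cW0]] := rank_basis (contract M Z) finset.setT.
  have WB0 : W0 \in bases (contract M Z) by apply/basesP.
  have mE e : (e \in [set val x | x in S]%SET)%:R = #|W0 :&: S|%:R * rho e.
    apply: prop_ind => [|B BB cB].
      by apply/fintype.subsetP => _ /imsetP[w _ ->]; exact: valP.
    by rewrite -card_lift; exact: separator_card sepS (contract_base BB cB) WB0.
  (* At [v], outside [S], the indicator is 0 while [rho] is not, so [m = 0]; evaluating at [u] in
     [S] then gives [1 = 0]. *)
  have m0 : #|W0 :&: S|%:R = 0 :> R.
    have /esym/eqP := mE (val v); rewrite (mem_imset _ _ val_inj) (negPf vS).
    rewrite mulf_eq0 -memZ; have := valP v; rewrite inE => /negPf ->.
    by rewrite orbF => /eqP.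
  have /eqP := mE (val u); rewrite (mem_imset _ _ val_inj) uS m0 mul0r.
  by rewrite oner_eq0.
- apply/ffunP => e; rewrite !ffunE -natrB ?rankS ?finset.subsetT // -/k kE.
  by rewrite [RHS]mulKf.
Qed.

(* Exchanging two elements of a circuit shows that [y] is constant on circuits of
   [M / Z], so its level sets are separators. *)
Lemma connected_constant Z y : connected (contract M Z) ->
  (forall e, e \in Z -> y e = 0) ->
  (forall B, B \in bases M -> #|B :\: Z| = (rk [set: E]%SET - rk Z)%N ->
     \sum_(e in B) y e = 1) ->
  y = ((rk [set: E]%SET)%:R - (rk Z)%:R)^-1 *: indicator R (~: Z).
Proof.
move=> conn yZ yB; have yW W : W \in bases (contract M Z) ->
    \sum_(x in W) y (val x) = 1.
  move=> WB; have [B BB BW] := contract_base_lift WB.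
  have /basesP[_ cW] := WB; rewrite rank_contractT in cW.
  rewrite -(yB B BB); last by rewrite BW card_imset //; exact: val_inj.
  rewrite [RHS](big_setID Z) /= BW [X in _ = X + _]big1 ?add0r.
    by rewrite big_imset //= => ? ? _ _; exact: val_inj.
  by move=> e; rewrite inE => /andP[_ /yZ].
apply/ffunP => e; rewrite !ffunE; have [eZ|eZ] := boolP (e \in Z).
  by rewrite yZ // inE eZ scaler0.
have eX : e \in ~: Z by rewrite inE.
pose x0 : {x : E | x \in ~: Z} := exist _ e eX.
pose S := [set x : {x : E | x \in ~: Z} | y (val x) == y e]%SET.
have circuit_cst C f g : circuit (contract M Z) C -> f \in C -> g \in C ->
    y (val f) = y (val g).
  move=> CC fC gC; case: (eqVneq f g) => [->//|nfg].
  (* Both bases have weight 1 and differ only by [f] against [g], so the weight of [W] cancels. *)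
  have [W [fW gW /yW + /yW]] := circuit_exchange CC fC gC nfg.
  by rewrite !big_setU1 //= => <- /addIr.
have sepS : separator (contract M Z) S.
  move=> C CC; have [CS|/fintype.subsetPn[f fC fS]] := boolP (C \subset S).
    by left.
  right; apply/fintype.subsetP => g gC; move: fS.
  by rewrite !inE (circuit_cst C f g).
have ST : S = finset.setT.
  by have [S0|//] := conn S sepS; have := finset.in_set0 x0; rewrite -S0 inE eqxx.
have [W [WI _ cW]] := rank_basis (contract M Z) finset.setT.
have := yW W; rewrite (eq_bigr (fun=> y e)) => [|x _]; last first.
  by apply/eqP; have := finset.in_setT x; rewrite -ST inE.
rewrite sumr_const cW rank_contractT -[y e *+ _]mulr_natl.
move=> /(_ (introT (basesP _ _) (conj WI cW))).
rewrite natrB ?rankS ?finset.subsetT // eX => h.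
(* The weight of a base of [M / Z] under the constant [y e] is [k * y e = 1], which forces [k] to be
   nonzero. *)
set k := _ - _ in h *; have k0 : k != 0.
  by apply: contra_eq_neq h => ->; rewrite mul0r eq_sym oner_neq0.
by rewrite -[RHS]/(k^-1 * 1) -h mulKf.
Qed.

Lemma Theta_extreme rho : Theta R M rho -> extreme_points Adm rho.
Proof.
move=> [X [/eqP/set0Pn[x xX] clX conn ->]].
have XE : X = ~: ~: X by rewrite finset.setCK.
have cBX B : #|B :&: X| = #|B :\: ~: X| by rewrite finset.setDE -XE.
set Z := ~: X in clX conn cBX *; set rT := rk [set: E]%SET.
(* Since [Z] is closed and misses [x], adding [x] raises its rank; the scaling factor is therefore a
   genuine inverse. *)
have ltZ : (rk Z < rT)%N.
  have xZ : x \notin Z by rewrite inE xX.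
  apply: (@leq_trans (rk (x |: Z))); last by rewrite rankS ?finset.subsetT.
  rewrite ltn_neqAle rankS ?finset.subsetUr // andbT eq_sym.
  by apply: contra xZ => h; rewrite -clX inE.
rewrite -(natrB _ (ltnW ltZ)); set k := (rT - rk Z)%N.
have k0 : 0 < k%:R :> R by rewrite ltr0n subn_gt0.
have sumB B : \sum_(e in B) (k%:R^-1 *: indicator R X) e = k%:R^-1 * #|B :\: Z|%:R.
  rewrite -cBX -sum_indicator mulr_sumr.
  by apply: eq_bigr => e _; rewrite !ffunE.
split.
  split=> [e|B BB]; first by rewrite !ffunE mulr_ge0 ?invr_ge0 ?(ltW k0).
  by rewrite sumB ler_pdivlMl // mulr1 ler_nat base_cardD_ge.
move=> y z t [y0 y1] [z0 z1] /andP[t0 t1] rhoE.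
have s0 : 0 < 1 - t by rewrite subr_gt0.
(* A proper convex combination that attains a common lower bound of its terms has both terms equal
   to it. This is used with bound 0 at coordinates in [Z] and bound 1 on tight bases. *)
have cvx (a b c : R) : c <= a -> c <= b -> c = t * a + (1 - t) * b -> a = c /\ b = c.
  move=> ca cb cE; have /eqP : t * (a - c) + (1 - t) * (b - c) = 0.
    by rewrite !mulrBr addrACA -cE -opprD -mulrDl [t + _]addrC subrK mul1r addrN.
  rewrite paddr_eq0 ?mulr_ge0 ?subr_ge0 ?(ltW t0) ?(ltW t1) //.
  by rewrite !mulf_eq0 (gt_eqF t0) (gt_eqF s0) /= !subr_eq0 => /andP[/eqP-> /eqP->].
have yz0 e : e \in Z -> y e = 0 /\ z e = 0.
  rewrite inE => /negPf eX; apply: cvx => //.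
  by have := congr1 (fun f : {ffun E -> R^o} => f e) rhoE; rewrite !ffunE eX scaler0.
have yz1 B : B \in bases M -> #|B :\: Z| = k ->
    \sum_(e in B) y e = 1 /\ \sum_(e in B) z e = 1.
  move=> BB cB; apply: cvx; [exact: y1 | exact: z1 |].
  have := sumB B; rewrite cB mulVf ?gt_eqF // rhoE => s1.
  rewrite -[LHS]s1 !mulr_sumr -big_split.
  by apply: eq_bigr => e _; rewrite !ffunE.
by split; rewrite natrB ?(ltnW ltZ) // [X in indicator R X]XE;
  apply: connected_constant => // [e /yz0[]|B BB /(yz1 _ BB)[]].
Qed.

End Blocker.

Theorem theorem6p2 (R : realType) (E : finType) (M : matroid E) :
  loopless M -> (0 < rank M [set: E]%SET)%N ->
  extreme_points (admissible R (bases M)) = Theta R M.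
Proof.
move=> _ _; apply/seteqP; split=> rho; [exact: extreme_Theta | exact: Theta_extreme].
Qed.
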